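(* Let $S=[0,\bar w]$ with $\bar w\in(0,\infty)$, let $Q_u$ and $Q_e$ be increasing stochastic kernels on $S$, let $\delta,\lambda>0$, and let $(P_t)_{t\ge0}$ be the Markov semigroup of the associated wage process. Suppose there exist $\hat w\in[0,\bar w]$, $n\in\mathbb N$ and $\epsilon>0$ such that $$Q_u^n(\bar w,[0,\hat w])\ge\epsilon\quad\text{and}\quad Q_e^n(0,[\hat w,\bar w])\ge\epsilon.$$ Then the wage process is globally stable, with unique stationary distribution $\phi^*$. Moreover, $$\beta(\phi P_t,\phi^* )\le Ce^{-\alpha t}\quad\text{for all }\phi\in\mathcal P(S)\text{ and }t\ge0,$$ where $$C:=\frac{2}{1-\kappa},\qquad \alpha:=\ln\frac{1}{1-\kappa},\qquad \kappa:=\frac{e^{-(\delta+\lambda)}(\delta\wedge\lambda)^n}{n!}\,\epsilon.$$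
   Context: $S=[0,\bar w]$ carries its usual order and topology. $\mathcal P(S)$ is the set of Borel probability measures on $S$; $ibS$ is the set of bounded increasing (Borel) functions on $S$; $\phi(h)=\int h\,d\phi$; $\phi\preceq_{\mathrm{sd}}\psi$ means $\phi(h)\le\psi(h)$ for all $h\in ibS$; $\beta(\phi,\psi)=\sup\{|\phi(h)-\psi(h)|:h\in ibS,\ |h|\le1\}$. A stochastic kernel $Q$ on $S$ is a map $(x,B)\mapsto Q(x,B)$ that is a probability measure in $B$ and measurable in $x$; it is increasing if $x\le x'$ implies $Q(x,\cdot)\preceq_{\mathrm{sd}}Q(x',\cdot)$; $Q^n$ is the $n$-step kernel; $(Qh)(x)=\int h(y)Q(x,dy)$ and $(\phi Q)(B)=\int Q(x,B)\phi(dx)$. Wage process. Job destructions arrive at rate $\delta$ and outside offers at rate $\lambda$, according to independent Poisson processes. At a destruction time, the wage $W_t$ is drawn from $Q_u(W_{t-},\cdot)$. At an offer time, $W^e_t$ is drawn from $Q_e(W_{t-},\cdot)$ and $W_t=\max(W_{t-},W^e_t)$. Between jumps $W_t$ is constant. Equivalently, let $Q_m(w,B)=\int \mathbf 1_B(\max(w,w'))\,Q_e(w,dw')$ and $$K=\frac{\delta}{\delta+\lambda}Q_u+\frac{\lambda}{\delta+\lambda}Q_m .$$ The Markov semigroup is $$(P_tf)(w)=\sum_{k=0}^\infty e^{-(\delta+\lambda)t}\frac{[(\delta+\lambda)t]^k}{k!}(K^kf)(w)$$ for bounded measurable $f$, $t\ge 0$. Global stability means that there is a unique $\phi^*\in\mathcal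 P(S)$ with $\phi^*P_t=\phi^*$ for all $t\ge0$, and $\beta(\phi P_t,\phi^* )\to0$ as $t\to\infty$ for all $\phi\in\mathcal P(S)$. $\mathbb N=\{1,2,\dots\}$ and $\delta\wedge\lambda=\min(\delta,\lambda)$. *)

(* Defs.v *)
From HB Require Import structures.
From mathcomp Require Import all_boot all_order all_algebra interval_inference.
From mathcomp Require Import all_classical all_reals all_analysis.
From mathcomp Require Import measurable_realfun.

Set Implicit Arguments.
Unset Strict Implicit.
Unset Printing Implicit Defensive.

Import Order.TTheory GRing.Theory Num.Theory.
Import numFieldNormedType.Exports.

Local Open Scope classical_set_scope.
Local Open Scope ring_scope.

Section kernels.
Context d (T : measurableType d) (R : realType).
Implicit Types (Q : R.-pker T ~> T) (phi psi : probability T R).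
Local Open Scope ereal_scope.

Definition kscale (r : {nonneg R}) (k : R.-ker T ~> T) (x : T) :
  {measure set T -> \bar R} := mscale r (k x).

Lemma measurable_kscale r k U : measurable U ->
  measurable_fun [set: T] (kscale r k ^~ U).
Proof.
move=> mU; apply: measurable_funeM.
exact: measurable_kernel.
Qed.

HB.instance Definition _ r k :=
  isKernel.Build _ _ _ _ _ (kscale r k) (@measurable_kscale r k).

Definition kcomp_pker Q1 Q2 : T -> {measure set T -> \bar R} :=
  mkcomp_noparam Q1 Q2.

HB.instance Definition _ Q1 Q2 := Kernel.on (kcomp_pker Q1 Q2).

Lemma kcomp_pker_prob Q1 Q2 x : kcomp_pker Q1 Q2 x [set: T] = 1.
Proof.
rewrite /kcomp_pker /mkcomp_noparam /= /kcomp_noparam.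
under eq_integral do rewrite prob_kernel.
by rewrite integral_cst// prob_kernel mul1e.
Qed.

HB.instance Definition _ Q1 Q2 :=
  Kernel_isProbability.Build _ _ _ _ _ (kcomp_pker Q1 Q2)
    (@kcomp_pker_prob Q1 Q2).

Fixpoint kpow Q (n : nat) : R.-pker T ~> T :=
  if n is n'.+1 then kcomp_pker Q (kpow Q n')
  else kdirac (@measurable_id _ T setT).

(* the measure phi Q, i.e. B |-> \int Q(x, B) phi(dx) *)
Definition kact phi Q (B : set T) : \bar R := \int[phi]_x Q x B.

Section kact_probability.
Variables (phi : probability T R) (Q : R.-pker T ~> T).

Let kact0 : kact phi Q set0 = 0.
Proof. by apply: integral0_eq => x _; rewrite measure0. Qed.

Let kact_ge0 B : 0 <= kact phi Q B.
Proof. exact: integral_ge0. Qed.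

Let kact_sigma_additive : semi_sigma_additive (kact phi Q).
Proof.
move=> F mF tF mUF; rewrite [X in _ --> X](_ : _ =
  \int[phi]_x (\sum_(n <oo) Q x (F n))); last first.
  apply: eq_integral => x _.
  by apply/esym/cvg_lim => //; exact/measure_semi_sigma_additive.
apply/cvg_closeP; split.
  by apply: is_cvg_nneseries => n _ _; exact: integral_ge0.
by rewrite closeE// integral_nneseries// => n; exact: measurable_kernel.
Qed.

HB.instance Definition _ := isMeasure.Build _ _ _ (kact phi Q)
  kact0 kact_ge0 kact_sigma_additive.

Let kact_setT : kact phi Q [set: T] = 1.
Proof.
rewrite /kact; under eq_integral do rewrite prob_kernel.
rewrite integral_cst// mul1e. exact: probability_setT.
Qed.

HB.instance Definition _ :=
  Measure_isProbability.Build _ _ _ (kact phi Q) kact_setT.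

End kact_probability.

Definition poisson_weight (r : {posnum R}) (t : {nonneg R}) (k : nat) : R :=
  (expR (- (r%:num * t%:num)) * (r%:num * t%:num) ^+ k / k`!%:R)%R.

Lemma poisson_weight_ge0 r t k : (0 <= poisson_weight r t k)%R.
Proof. by rewrite !mulr_ge0// ?expR_ge0// exprn_ge0// mulr_ge0. Qed.

Lemma sum_poisson_weight r t : \sum_(k <oo) (poisson_weight r t k)%:E = 1.
Proof.
pose a := (r%:num * t%:num)%R.
have a0 : (0 <= a)%R by rewrite mulr_ge0.
under eq_eseriesr do rewrite /poisson_weight -mulrA EFinM.
rewrite /= nneseriesZl/=; last first.
  by move=> n _; rewrite lee_fin divr_ge0// exprn_ge0.
rewrite -/a [X in _ * X](_ : _ = (expR a)%:E).
  by rewrite -EFinM expRN mulVf ?gt_eqF ?expR_gt0.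
rewrite expRE -EFin_lim; last first.
  rewrite /pseries/=; under eq_fun do rewrite mulrC.
  exact: is_cvg_series_exp_coeff.
apply/congr_lim/funext => n/=; rewrite /pseries/= /series/= -sumEFin//.
by under eq_bigr do rewrite mulrC.
Qed.

(* P_t(x, B) = \sum_k e^{-rt} (rt)^k / k! Q^k(x, B), i.e. P_t applied to the
   indicator of B; integral_poisson_semigroup below gives the operator form
   on bounded measurable functions *)
Definition poisson_semigroup (r : {posnum R}) Q (t : {nonneg R}) :
    T -> {measure set T -> \bar R} :=
  kseries (fun k => kscale (NngNum (poisson_weight_ge0 r t k)) (kpow Q k)).

HB.instance Definition _ r Q t := Kernel.on (poisson_semigroup r Q t).

Lemma poisson_semigroup_prob r Q t x :
  poisson_semigroup r Q t x [set: T] = 1.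
Proof.
rewrite /poisson_semigroup /kseries/= /mseries -[RHS](sum_poisson_weight r t).
apply: eq_eseriesr => k _.
by rewrite /kscale/= /mscale/= prob_kernel mule1.
Qed.

HB.instance Definition _ r Q t := Kernel_isProbability.Build _ _ _ _ _
  (poisson_semigroup r Q t) (@poisson_semigroup_prob r Q t).

Lemma integral_poisson_semigroup r Q t x (f : T -> R) :
  measurable_fun [set: T] f -> (exists M : R, forall y, (`|f y| <= M)%R) ->
  \int[poisson_semigroup r Q t x]_y (f y)%:E =
  \sum_(k <oo) (poisson_weight r t k)%:E * \int[kpow Q k x]_y (f y)%:E.
Proof.
move=> mf [M fM].
have mEf : measurable_fun [set: T] (EFin \o f) by exact/measurable_EFinP.
have M0 : (0 <= M)%R by exact: le_trans (fM x).
have bf : [bounded f y | y in [set: T]].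
  exists M; split; first exact: num_real.
  by move=> N MN y _; exact: le_trans (fM y) (ltW MN).
pose m k := kscale (NngNum (poisson_weight_ge0 r t k)) (kpow Q k) x.
have mT k : m k setT = (poisson_weight r t k)%:E.
  by rewrite /m /kscale/= /mscale/= prob_kernel mule1.
have mfin k : (m k).-integrable setT (EFin \o f).
  by apply: measurable_bounded_integrable => //; rewrite mT ltry.
have le_wM k (g : T -> \bar R) : measurable_fun setT g ->
    (forall y, 0 <= g y <= M%:E) ->
    `|\int[m k]_y g y| <= M%:E * (poisson_weight r t k)%:E.
  move=> mg gM; rewrite gee0_abs; last first.
    by apply: integral_ge0 => y _; have /andP[] := gM y.
  rewrite -mT -integral_cst//; apply: ge0_le_integral => //.
  - by move=> y _; have /andP[] := gM y.
  - by move=> y _; have /andP[] := gM y.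
have sum_fin (g : T -> \bar R) : measurable_fun setT g ->
    (forall y, 0 <= g y <= M%:E) -> \sum_(k <oo) `|\int[m k]_y g y| < +oo.
  move=> mg gM; apply: (@le_lt_trans _ _
    (\sum_(k <oo) (M%:E * (poisson_weight r t k)%:E))).
    by apply: lee_nneseries => [k *|k *]; [exact: abse_ge0|exact: le_wM].
  rewrite nneseriesZl; last by move=> k _; rewrite lee_fin poisson_weight_ge0.
  by rewrite sum_poisson_weight mule1 ltry.
transitivity (\sum_(k <oo) \int[m k]_y (f y)%:E).
  rewrite /poisson_semigroup /kseries/= integral_measure_series//.
  - apply: sum_fin; first exact: measurable_funeneg.
    move=> y; rewrite funeneg_ge0/= funenegE ge_max /comp -EFinN !lee_fin M0 andbT.
    by rewrite (le_trans (ler_norm _))// normrN.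
  - apply: sum_fin; first exact: measurable_funepos.
    move=> y; rewrite funepos_ge0/= funeposE ge_max /comp !lee_fin M0 andbT.
    by rewrite (le_trans (ler_norm _)).
apply: eq_eseriesr => k _; rewrite /m /kscale/=.
have kfin : (kpow Q k x).-integrable setT (EFin \o f).
  apply: measurable_bounded_integrable => //.
  by rewrite prob_kernel ltry.
rewrite [in LHS]integralE [in RHS]integralE.
rewrite ge0_integral_mscale//; last exact: measurable_funepos.
rewrite ge0_integral_mscale//; last exact: measurable_funeneg.
rewrite -muleBr//; apply: fin_num_adde_defl; rewrite fin_numN.
exact: integrable_neg_fin_num.
Qed.

End kernels.

Section wage_space.
Context {R : realType} (wbar : {posnum R}).

Definition wage_space : Type := `[0, wbar%:num]%classic.

HB.instance Definition _ := SubChoice.on wage_space.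
HB.instance Definition _ := Topological.on wage_space.
HB.instance Definition _ :=
  [SubChoice_isSubOrder of wage_space by <: with ring_display].

Lemma wmin_subproof : (0 : R) \in `[0, wbar%:num]%classic.
Proof. by rewrite inE/= in_itv/= lexx/=. Qed.

Lemma wmax_subproof : wbar%:num \in `[0, wbar%:num]%classic.
Proof. by rewrite inE/= in_itv/= lexx andbT. Qed.

Definition wmin : wage_space := Sub 0 wmin_subproof.
Definition wmax : wage_space := Sub wbar%:num wmax_subproof.

HB.instance Definition _ := isPointed.Build wage_space wmin.

(* generated by the open sets of the topology induced by that of R *)
HB.instance Definition _ := @isMeasurable.Build
  (sigma_display (@open wage_space)) wage_space <<s @open wage_space >>
  (@sigma_algebra0 _ setT _) (@sigma_algebraC _ _)
  (@sigma_algebra_bigcup _ setT _).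

Lemma measurable_wage_spaceE :
  @measurable _ wage_space = preimage_set_system setT val (@measurable _ R).
Proof.
have -> : @measurable _ R = (@open R).-sigma.-measurable.
  apply/seteqP; split.
    rewrite [X in X `<=` _](RGenOpens.measurableE R).
    apply: smallest_sub; first exact: sigma_algebra_measurable.
    by move=> _ [x [y ->]]; apply: sub_sigma_algebra; exact: interval_open.
  apply: smallest_sub; first exact: sigma_algebra_measurable.
  by move=> A oA; exact: open_measurable.
rewrite -g_sigma_preimageE; congr (<<s _ >>); apply/seteqP; split.
  by move=> A [B oB <-]; exists B => //; rewrite setTI.
by move=> A [B oB <-]; exists B => //; rewrite setTI.
Qed.

Lemma measurable_wage_val : measurable_fun [set: wage_space] (val : _ -> R).
Proof.
by move=> _ B mB; rewrite measurable_wage_spaceE; exists B.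
Qed.

Lemma val_wage_max (x y : wage_space) :
  val (Num.max x y) = Num.max (val x) (val y).
Proof. by rewrite !maxEle -[val x <= _]/(x <= y); case: ifP. Qed.

Lemma measurable_wage_max : measurable_fun [set: wage_space * wage_space]
  (fun p => Num.max p.1 p.2).
Proof.
have mm : measurable_fun [set: wage_space * wage_space]
    (fun p => Num.max (val p.1) (val p.2)).
  by apply: measurable_maxr; apply: (measurableT_comp measurable_wage_val).
move=> _ A; rewrite measurable_wage_spaceE => -[B mB <-]; rewrite !setTI.
have := mm measurableT B mB; rewrite setTI; congr (measurable _).
by apply/seteqP; split => -[x y]; rewrite /preimage/= val_wage_max.
Qed.

End wage_space.

Section wage_process.
Context {R : realType} {wbar : {posnum R}}.
Local Notation S := (wage_space wbar).
Implicit Types (Q Qu Qe : R.-pker S ~> S) (phi psi : probability S R).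
Implicit Types (delta lambda : {posnum R}) (t : {nonneg R}).

Definition ibS (h : S -> R) : Prop :=
  [/\ measurable_fun setT h, {homo h : x y / x <= y}
    & exists M : R, forall x, `|h x| <= M].

Definition sd_le (phi psi : {measure set S -> \bar R}) : Prop :=
  forall h, ibS h -> \int[phi]_x h x <= \int[psi]_x h x.

(* The set contains 0 and is bounded above by 2, so that the real-valued sup
   is its least upper bound. *)
Definition beta phi psi : R :=
  sup [set `|\int[phi]_x h x - \int[psi]_x h x|
      | h in [set h | ibS h /\ forall x, `|h x| <= 1]].

Definition increasing_kernel Q : Prop :=
  forall x x', x <= x' -> sd_le (Q x) (Q x').

(* Q_m: the wage after an offer is the maximum of the current wage and of the
   offer drawn from Q = Q_e; see offer_kernelE *)
Definition offer_kernel Q : S -> {measure set S -> \bar R} :=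
  (Q \; kdirac (@measurable_wage_max R wbar))%E.

HB.instance Definition _ Q := Kernel.on (offer_kernel Q).

Lemma offer_kernelE Q w B :
  offer_kernel Q w B = (\int[Q w]_w' (\1_B (Num.max w w'))%:E)%E.
Proof. by []. Qed.

Lemma offer_kernel_prob Q w : offer_kernel Q w [set: S] = 1%E.
Proof.
rewrite offer_kernelE (eq_integral (cst 1%E)) => [|y _]; last by rewrite indicT.
by rewrite integral_cst// mul1e prob_kernel.
Qed.

HB.instance Definition _ Q := Kernel_isProbability.Build _ _ _ _ _
  (offer_kernel Q) (@offer_kernel_prob Q).

Definition jump_kernel delta lambda Qu Qe :
    S -> {measure set S -> \bar R} :=
  kadd (kscale (delta%:num / (delta%:num + lambda%:num))%:nng Qu)
       (kscale (lambda%:num / (delta%:num + lambda%:num))%:nng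
               (offer_kernel Qe)).

HB.instance Definition _ delta lambda Qu Qe :=
  Kernel.on (jump_kernel delta lambda Qu Qe).

Lemma jump_kernelE delta lambda Qu Qe w B :
  jump_kernel delta lambda Qu Qe w B =
  ((delta%:num / (delta%:num + lambda%:num))%:E * Qu w B +
   (lambda%:num / (delta%:num + lambda%:num))%:E * offer_kernel Qe w B)%E.
Proof. exact: measure_addE. Qed.

Lemma jump_kernel_prob delta lambda Qu Qe w :
  jump_kernel delta lambda Qu Qe w [set: S] = 1%E.
Proof.
by rewrite jump_kernelE !prob_kernel !mule1 -EFinD -mulrDl divff.
Qed.

HB.instance Definition _ delta lambda Qu Qe :=
  Kernel_isProbability.Build _ _ _ _ _ (jump_kernel delta lambda Qu Qe)
    (@jump_kernel_prob delta lambda Qu Qe).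

Definition wage_semigroup delta lambda Qu Qe t : R.-pker S ~> S :=
  poisson_semigroup (delta%:num + lambda%:num)%:pos
    (jump_kernel delta lambda Qu Qe) t.

(* Measures are functions on all sets, whose values on nonmeasurable sets are
   irrelevant: they are compared on measurable sets only, here and below. *)
Definition stationary (P : {nonneg R} -> R.-pker S ~> S) phi : Prop :=
  forall t B, measurable B -> kact phi (P t) B = phi B.

(* phistar is the unique stationary distribution and attracts every phi.
   P is only defined at nonnegative times; `|t| = t as t tends to +oo. *)
Definition globally_stable (P : {nonneg R} -> R.-pker S ~> S)
    (phistar : probability S R) : Prop :=
  [/\ stationary P phistar,
      forall psi, stationary P psi ->
        forall B, measurable B -> psi B = phistar B
    & forall phi,
        (fun t : R => beta (kact phi (P `|t|%:nng)) phistar) @ +oo --> (0 : R)].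

End wage_process.

(* Main.v *)
Require Import Defs.
From HB Require Import structures.
From mathcomp Require Import all_boot all_order all_algebra interval_inference.
From mathcomp Require Import all_classical all_reals all_analysis.
From mathcomp Require Import measurable_realfun.
From mathcomp Require Import ring lra.

Import Order.TTheory GRing.Theory Num.Theory.
Import numFieldNormedType.Exports.

Local Open Scope classical_set_scope.
Local Open Scope ring_scope.

Set Implicit Arguments.
Unset Strict Implicit.
Unset Printing Implicit Defensive.

(** The functions to watch are the increasing ones, whose oscillation is
    h (wmax wbar) - h (wmin wbar), and the point is that one unit of time
    shrinks their oscillation by the factor 1 - kappa.

    With probability at least kappa, the process started from wbar is at time 1
    below the threshold given by the variable what, and the process started from
    0 is at time 1 above this threshold ([wage_semigroup1_mixing]): it suffices that exactly n jumps occur and that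
    they are all destructions, respectively all offers; offers that may be
    declined only do better than Q_e, by monotonicity. The two means of an
    increasing h at time 1 then both contain kappa * h what, which cancels in
    their difference ([mixing_contracts_oscillation]). As the kernels are
    increasing, this contraction can be iterated; the semigroup property
    P_s P_t = P_(s+t) ([kernel_op_poissonD]) gives the oscillation of P_t h for
    t between m and m + 1 the factor (1 - kappa)^m. As the means of a function
    under two laws differ by at most its oscillation, this proves at once the
    uniqueness of the stationary distribution and the rate, the constant
    2 / (1 - kappa) paying for the bound 2 on the oscillation of h and for
    rounding t down.

    It remains to construct a stationary distribution. The laws at integer times
    of the process started from the bottom have distribution functions that are
    uniformly Cauchy, because indicators of upper rays are increasing; the limit
    is a distribution function, hence comes from a law
    ([exists_probability_cdf]). Convergence extends from upper rays to all
    increasing functions by the layer cake formula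
    ([dist_mean_le_of_upper_rays]), and one more step of the chain shows that
    the limit law is invariant at time 1 ([contracting_invariant_exists]). Being
    unique with this property, it is invariant at all times, since the operators
    of the semigroup commute ([stationary_exists]). *)

(** * Means of bounded measurable functions *)

Definition bounded_measurable d (T : measurableType d) (R : realType)
    (h : T -> R) : Prop :=
  measurable_fun setT h /\ exists M : R, forall x, `|h x| <= M.

Section mean.
Context d (T : measurableType d) (R : realType).
Implicit Types (h g : T -> R).

Lemma bounded_measurable_affine a b h :
  bounded_measurable h -> bounded_measurable (fun x => a * h x + b).
Proof.
move=> [mh [M hM]]; split.
  by apply: measurable_funD => //; apply: measurable_funM.
exists (`|a| * M + `|b|) => x; rewrite (le_trans (ler_normD _ _))// lerD2r.
by rewrite normrM ler_wpM2l.
Qed.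

Lemma bounded_measurable_indic (A : set T) :
  measurable A -> bounded_measurable (\1_A : T -> R).
Proof.
by move=> mA; split=> //; exists 1 => x; rewrite ger0_norm ?ler0n// lern1 leq_b1.
Qed.

Section probability_mean.
Variable m : {measure set T -> \bar R}.
Hypothesis mT : m setT = 1%E.

Lemma bounded_measurable_integrable h :
  bounded_measurable h -> m.-integrable setT (EFin \o h).
Proof.
move=> [mh [M hM]]; apply: measurable_bounded_integrable => //.
  by rewrite mT ltry.
exists M; split; first exact: num_real.
by move=> N MN y _; exact: le_trans (hM y) (ltW MN).
Qed.

Lemma mean_EFin h : bounded_measurable h ->
  (\int[m]_x h x)%:E = (\int[m]_x (h x)%:E)%E.
Proof.
move=> /bounded_measurable_integrable mh; rewrite fineK//.
exact: integrable_fin_num.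
Qed.

Lemma mean_cst c : \int[m]_x (c : R) = c.
Proof. by rewrite Rintegral_cst// mT mulr1. Qed.

Lemma mean_affine a b h : bounded_measurable h ->
  \int[m]_x (a * h x + b) = a * (\int[m]_x h x) + b.
Proof.
move=> bh; have ih := bounded_measurable_integrable bh.
rewrite RintegralD//; first last.
- by apply: bounded_measurable_integrable; split => //; exists `|b|.
- have bah := bounded_measurable_affine a 0 bh.
  by under eq_fun do rewrite -[_ * _]addr0; exact: bounded_measurable_integrable.
by rewrite RintegralZl// mean_cst.
Qed.

Lemma mean_translation c h : bounded_measurable h ->
  \int[m]_x (h x + c) = \int[m]_x h x + c.
Proof.
move=> bh; rewrite -[X in _ = X + c]mul1r -mean_affine//.
by under [RHS]eq_Rintegral do rewrite mul1r.
Qed.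

Lemma le_mean h g : bounded_measurable h -> bounded_measurable g ->
  (forall x, h x <= g x) -> \int[m]_x h x <= \int[m]_x g x.
Proof.
by move=> bh bg hg; apply: le_Rintegral => //; exact: bounded_measurable_integrable.
Qed.

Lemma mean_le c h : bounded_measurable h -> (forall x, h x <= c) ->
  \int[m]_x h x <= c.
Proof.
move=> bh hc; rewrite -[leRHS]mean_cst; apply: le_mean => //.
by split=> //; exists `|c|.
Qed.

Lemma mean_ge c h : bounded_measurable h -> (forall x, c <= h x) ->
  c <= \int[m]_x h x.
Proof.
move=> bh hc; rewrite -[leLHS]mean_cst; apply: le_mean => //.
by split=> //; exists `|c|.
Qed.

Lemma mean_indic (A : set T) : measurable A ->
  \int[m]_x (\1_A x : R) = fine (m A).
Proof. by move=> mA; rewrite /Rintegral integral_indic// setIT. Qed.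

End probability_mean.

(** Every bounded function is a translate of a nonnegative one: this is how
    the theory of nonnegative integrals applies to signed functions. *)
Lemma eq_translation_ge0 (F G : (T -> R) -> R) :
  (forall c h, bounded_measurable h -> F (fun x => h x + c) = F h + c) ->
  (forall c h, bounded_measurable h -> G (fun x => h x + c) = G h + c) ->
  (forall h, bounded_measurable h -> (forall x, 0 <= h x) -> F h = G h) ->
  forall h, bounded_measurable h -> F h = G h.
Proof.
move=> FD GD FG h bh; have [_ [M hM]] := bh; apply: (@addIr _ M).
rewrite -FD// -GD//; apply: FG => [|x].
  by have := bounded_measurable_affine 1 M bh; under eq_fun do rewrite mul1r.
by rewrite -lerBlDr sub0r; have := hM x; rewrite ler_norml => /andP[].
Qed.

End mean.

(** * Kernels acting on bounded measurable functions *)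

Section total_mass1.
Context d (T : measurableType d) (R : realType).

(** A kernel provides bare measures; results on probabilities are applied to
    them through this alias, which carries the probability structure. *)
Definition total_mass1 (m : {measure set T -> \bar R}) (_ : m setT = 1%E) :
  set T -> \bar R := m.

HB.instance Definition _ m mT := Measure.copy (@total_mass1 m mT) m.

HB.instance Definition _ m mT :=
  Measure_isProbability.Build _ _ _ (@total_mass1 m mT) mT.

End total_mass1.

Section kernel_operator.
Context d (T : measurableType d) (R : realType).
Implicit Types (Q : R.-pker T ~> T) (h : T -> R).
Implicit Types (r : {posnum R}) (s t u : {nonneg R}).

Definition kernel_op Q h (x : T) : R := \int[Q x]_y h y.

Lemma kernel_op_affine Q a b h : bounded_measurable h ->
  kernel_op Q (fun x => a * h x + b) = (fun x => a * kernel_op Q h x + b).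
Proof. by move=> bh; apply/funext => x; apply: mean_affine; rewrite ?prob_kernel. Qed.

Lemma kernel_op_translation Q c h : bounded_measurable h ->
  kernel_op Q (fun x => h x + c) = (fun x => kernel_op Q h x + c).
Proof.
by move=> bh; apply/funext => x; apply: mean_translation; rewrite ?prob_kernel.
Qed.

Lemma kernel_op_EFin Q h x : bounded_measurable h ->
  (kernel_op Q h x)%:E = (\int[Q x]_y (h y)%:E)%E.
Proof. by apply: mean_EFin; rewrite prob_kernel. Qed.

Lemma le_kernel_op Q h g x : bounded_measurable h -> bounded_measurable g ->
  (forall y, h y <= g y) -> kernel_op Q h x <= kernel_op Q g x.
Proof. by apply: le_mean; rewrite prob_kernel. Qed.

Lemma kernel_op_le Q c h x : bounded_measurable h -> (forall y, h y <= c) ->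
  kernel_op Q h x <= c.
Proof. by apply: mean_le; rewrite prob_kernel. Qed.

Lemma kernel_op_ge Q c h x : bounded_measurable h -> (forall y, c <= h y) ->
  c <= kernel_op Q h x.
Proof. by apply: mean_ge; rewrite prob_kernel. Qed.

Lemma kernel_op_indic Q A x : measurable A ->
  kernel_op Q \1_A x = fine (Q x A).
Proof. exact: mean_indic. Qed.

Lemma bounded_measurable_kernel_op Q h :
  bounded_measurable h -> bounded_measurable (kernel_op Q h).
Proof.
move=> bh; have [mh [M hM]] := bh; split; last first.
  exists M => x; rewrite ler_norml; apply/andP; split.
    by apply: kernel_op_ge => // y; have := hM y; rewrite ler_norml => /andP[].
  by apply: kernel_op_le => // y; have := hM y; rewrite ler_norml => /andP[].
have -> : kernel_op Q h =
    (fun x => fine (\int[Q x]_y (h y + M)%:E)%E - M).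
  apply/funext => x.
  rewrite [fine _](_ : _ = kernel_op Q (fun y => h y + M) x)//.
  by rewrite kernel_op_translation// addrK.
apply: measurable_funB => //; apply: measurableT_comp => //.
apply: measurable_fun_integral_kernel => [U mU|z|].
- exact: measurable_kernel.
- rewrite lee_fin -lerBlDr sub0r; have := hM z.
  by rewrite ler_norml => /andP[].
- by apply/measurable_EFinP; exact: measurable_funD.
Qed.

(** A mixture of the laws Q x is the composition of a kernel that is constant on
    a one-point space with Q, so that the change of variables for composed
    kernels applies. *)
Lemma ge0_integral_mixture (m mQ : {measure set T -> \bar R}) Q
    (f : T -> \bar R) : m setT = 1%E ->
  (forall A, measurable A -> mQ A = \int[m]_x Q x A)%E ->
  (forall x, 0 <= f x)%E -> measurable_fun setT f ->
  (\int[mQ]_z f z = \int[m]_x \int[Q x]_z f z)%E.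
Proof.
move=> mT mQE f0 mf.
pose P : probability T R := total_mass1 mT.
have mP : measurable_fun [set: unit] (fun _ : unit => (P : pprobability T R)).
  exact: measurable_cst.
rewrite -(@integral_kcomp _ _ _ _ _ _ _ (kprobability mP)
  (kernel.kernel_snd Q) tt)//.
apply: eq_measure_integral => A mA _; rewrite mQE//.
Qed.

Lemma mean_mixture (m mQ : {measure set T -> \bar R}) Q h :
  m setT = 1%E ->
  (forall A, measurable A -> mQ A = \int[m]_x Q x A)%E ->
  bounded_measurable h -> \int[mQ]_z h z = \int[m]_x kernel_op Q h x.
Proof.
move=> mT mQE; have mQT : mQ setT = 1%E.
  rewrite mQE//; under eq_integral do rewrite prob_kernel.
  by rewrite integral_cst// mul1e mT.
move: h; apply: eq_translation_ge0 => [c h bh|c h bh|h bh h0].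
- exact: mean_translation.
- rewrite kernel_op_translation// mean_translation//.
  exact: bounded_measurable_kernel_op.
apply: EFin_inj; rewrite !mean_EFin//; last exact: bounded_measurable_kernel_op.
rewrite (ge0_integral_mixture mT mQE)//; last by case: bh => /measurable_EFinP.
by apply: eq_integral => x _; rewrite kernel_op_EFin.
Qed.

Lemma mean_kact (phi : probability T R) Q h : bounded_measurable h ->
  \int[kact phi Q]_z h z = \int[phi]_x kernel_op Q h x.
Proof. exact: (mean_mixture (probability_setT phi)). Qed.

Lemma kernel_op_kcomp Q Q' h : bounded_measurable h ->
  kernel_op (kcomp_pker Q Q') h = kernel_op Q (kernel_op Q' h).
Proof.
by move=> bh; apply/funext => x; apply: mean_mixture => //; rewrite prob_kernel.
Qed.

Lemma bounded_measurable_iter_kernel_op Q n h :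
  bounded_measurable h -> bounded_measurable (iter n (kernel_op Q) h).
Proof.
by move=> bh; elim: n => //= n; exact: bounded_measurable_kernel_op.
Qed.

Lemma iter_kernel_op_ge0 Q n h x : bounded_measurable h ->
  (forall y, 0 <= h y) -> 0 <= iter n (kernel_op Q) h x.
Proof.
move=> bh h0; elim: n x => //= n ih x; apply: kernel_op_ge => //.
exact: bounded_measurable_iter_kernel_op.
Qed.

Lemma kernel_op_kpow Q n h : bounded_measurable h ->
  kernel_op (kpow Q n) h = iter n (kernel_op Q) h.
Proof.
move=> bh; elim: n => [|n ih]; last by rewrite [LHS]kernel_op_kcomp// ih.
apply/funext => x; apply: EFin_inj; rewrite kernel_op_EFin//=.
rewrite [LHS]integral_dirac//; last by case: bh => /measurable_EFinP.
by rewrite diracT mul1e.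
Qed.

Lemma kernel_op_poisson r Q t h x : bounded_measurable h ->
  (kernel_op (poisson_semigroup r Q t) h x)%:E =
  (\sum_(k <oo) (poisson_weight r t k * iter k (kernel_op Q) h x)%:E)%E.
Proof.
move=> bh; rewrite kernel_op_EFin// integral_poisson_semigroup; try by case: bh.
by apply: eq_eseriesr => k _; rewrite -kernel_op_EFin// kernel_op_kpow.
Qed.

Lemma poisson_weightD r s t u n : s%:num + t%:num = u%:num ->
  \sum_(j < n.+1) poisson_weight r s j * poisson_weight r t (n - j)%N =
  poisson_weight r u n.
Proof.
move=> stu; rewrite /poisson_weight -stu mulrDr opprD expRD.
rewrite [X in X ^+ n]addrC exprDn mulr_sumr mulr_suml; apply: eq_bigr => j _.
rewrite -[_ *+ 'C(n, j)]mulr_natr.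
have jn : (j <= n)%N by rewrite -ltnS.
have -> : 'C(n, j)%:R = n`!%:R / (j`!%:R * (n - j)`!%:R) :> R.
  by rewrite -(bin_fact jn) 2!natrM mulfK// mulf_neq0// pnatr_eq0 -lt0n fact_gt0.
have nz k : k`!%:R != 0 :> R by rewrite pnatr_eq0 -lt0n fact_gt0.
by field; rewrite !nz.
Qed.

(** Distributing the product of two Poisson series and collecting the terms
    according to the total number of jumps reduces the semigroup property to
    the binomial formula. *)
Lemma kernel_op_poissonD r Q s t u h : s%:num + t%:num = u%:num ->
  bounded_measurable h ->
  kernel_op (poisson_semigroup r Q s) (kernel_op (poisson_semigroup r Q t) h) =
  kernel_op (poisson_semigroup r Q u) h.
Proof.
move=> stu bh; apply/funext => x; move: h bh.
have bP v h : bounded_measurable h ->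
    bounded_measurable (kernel_op (poisson_semigroup r Q v) h).
  exact: bounded_measurable_kernel_op.
apply: eq_translation_ge0 => [c h bh|c h bh|h bh h0].
- by rewrite kernel_op_translation// kernel_op_translation//; exact: bP.
- by rewrite kernel_op_translation.
have bK k := bounded_measurable_iter_kernel_op Q k bh.
have K0 k y : 0 <= iter k (kernel_op Q) h y by exact: iter_kernel_op_ge0.
have w0 v k : 0 <= poisson_weight r v k by exact: poisson_weight_ge0.
pose F (j n : nat) : \bar R := if (j <= n)%N then
  (poisson_weight r s j * poisson_weight r t (n - j)%N *
   iter n (kernel_op Q) h x)%:E else 0%E.
have F0 j n : (0 <= F j n)%E.
  by rewrite /F; case: ifP => // _; rewrite lee_fin !mulr_ge0.
apply: EFin_inj.
apply: (etrans (kernel_op_poisson r Q s x (bP t h bh))).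
apply/esym/(etrans (kernel_op_poisson r Q u x bh))/esym.
transitivity (\sum_(j <oo) \sum_(n <oo) F j n)%E; last first.
  rewrite nneseries_interchange//; apply: eq_eseriesr => n _.
  rewrite (@nneseries_split _ _ 0%N n.+1)// eseries0; last first.
    by move=> j; rewrite add0n /F => nj _; rewrite leqNgt nj.
  rewrite adde0 add0n big_mkord -(poisson_weightD _ _ stu) mulr_suml -sumEFin.
  by apply: eq_bigr => j _; rewrite /F -ltnS ltn_ord.
apply: eq_eseriesr => j _.
rewrite (@nneseries_split _ _ 0%N j)// big1_seq ?add0e; last first.
  by move=> n; rewrite mem_index_iota/= add0n /F => nj; rewrite leqNgt nj.
rewrite -nneseries_addn// -kernel_op_kpow; last exact: bP.
rewrite EFinM kernel_op_EFin; last exact: bP.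
under eq_integral do rewrite kernel_op_poisson//.
rewrite integral_nneseries//; first last.
- by move=> k y _; rewrite lee_fin mulr_ge0.
- move=> k; apply: measurableT_comp => //.
  by apply: measurable_funM => //; case: (bK k).
rewrite -[LHS]nneseriesZl; last first.
  by move=> k _; apply: integral_ge0 => y _; rewrite lee_fin mulr_ge0.
apply: eq_eseriesr => k _; rewrite /F leq_addl addnK.
under eq_integral do rewrite EFinM.
rewrite ge0_integralZl//; first last.
- by rewrite lee_fin.
- by move=> y _; rewrite lee_fin.
- by apply: measurableT_comp => //; case: (bK k).
rewrite -kernel_op_EFin// -!EFinM kernel_op_kpow// -iterD addnC.
by rewrite mulrA.
Qed.

End kernel_operator.
(** * Increasing functions and the contraction of their oscillation *)

Section increasing_functions.
Context {R : realType} {wbar : {posnum R}}.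
Local Notation S := (wage_space wbar).
Implicit Types (h : S -> R) (Q : R.-pker S ~> S).

Lemma wmin_le (x : S) : wmin wbar <= x.
Proof.
have : `[0, wbar%:num]%classic (val x) by have := valP x; rewrite inE.
by rewrite /= in_itv/= => /andP[].
Qed.

Lemma le_wmax (x : S) : x <= wmax wbar.
Proof.
have : `[0, wbar%:num]%classic (val x) by have := valP x; rewrite inE.
by rewrite /= in_itv/= => /andP[].
Qed.

Lemma ibS_bounded_measurable h : ibS h -> bounded_measurable h.
Proof. by case=> mh _ [M hM]; split=> //; exists M. Qed.

Lemma ibS_ge h x : ibS h -> h (wmin wbar) <= h x.
Proof. by case=> _ hh _; exact/hh/wmin_le. Qed.

Lemma ibS_le h x : ibS h -> h x <= h (wmax wbar).
Proof. by case=> _ hh _; exact/hh/le_wmax. Qed.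

Lemma ibS_intro h : bounded_measurable h -> {homo h : x y / x <= y} -> ibS h.
Proof. by move=> [mh [M hM]] hh; split=> //; exists M. Qed.

Lemma ibS_translation c h : ibS h -> ibS (fun x => h x + c).
Proof.
move=> ih; apply: ibS_intro.
  have := bounded_measurable_affine 1 c (ibS_bounded_measurable ih).
  by under eq_fun do rewrite mul1r.
by move=> x y xy; rewrite lerD2r; case: ih => _ + _; exact.
Qed.

Lemma ibS_indic (A : set S) : measurable A ->
  (forall x y, x <= y -> A x -> A y) -> ibS (\1_A : S -> R).
Proof.
move=> mA upA; apply: ibS_intro; first exact: bounded_measurable_indic.
move=> x y xy; rewrite !indicE ler_nat.
have [/set_mem Ax|//] := boolP (x \in A).
by rewrite mem_set//; exact: upA xy Ax.
Qed.

Definition above (r : R) : set S := [set x | r < val x].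

Lemma measurable_above (r : R) : measurable (above r).
Proof.
rewrite measurable_wage_spaceE; exists `]r, +oo[%classic => //.
by rewrite setTI; apply/seteqP; split => x /=; rewrite in_itv/= andbT.
Qed.

Lemma measurable_wage_ge (r : R) : measurable [set x : S | r <= val x].
Proof.
rewrite measurable_wage_spaceE; exists `[r, +oo[%classic => //.
by rewrite setTI; apply/seteqP; split => x /=; rewrite in_itv/= andbT.
Qed.

Lemma itv_wminE (w : S) :
  `[wmin wbar, w]%classic = ~` above (val w).
Proof.
apply/seteqP; split=> x /=; rewrite in_itv/= wmin_le/= leNgt; first by move/negP.
by move=> /negP.
Qed.

Lemma itv_wmaxE (w : S) : `[w, wmax wbar]%classic = [set x | val w <= val x].
Proof. by apply/seteqP; split=> x /=; rewrite in_itv/= le_wmax andbT. Qed.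

Lemma increasing_kernelP Q :
  increasing_kernel Q <-> (forall h, ibS h -> ibS (kernel_op Q h)).
Proof.
split=> [iQ h ih|iQ x y xy h ih]; last by case: (iQ h ih) => _ + _; exact.
apply: ibS_intro; last by move=> x y xy; exact: iQ.
exact/bounded_measurable_kernel_op/ibS_bounded_measurable.
Qed.

(** Series and integrals are only compared for nonnegative functions; an
    increasing function becomes nonnegative once its minimum is subtracted. *)
Lemma increasing_kernel_ge0 Q :
  (forall h, ibS h -> (forall x, 0 <= h x) ->
    {homo kernel_op Q h : x y / x <= y}) ->
  increasing_kernel Q.
Proof.
move=> Q0 x y xy h ih; pose c := - h (wmin wbar).
have bh := ibS_bounded_measurable ih.
have := Q0 _ (ibS_translation c ih) _ x y xy.
rewrite kernel_op_translation// lerD2r; apply=> z.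
by rewrite subr_ge0 ibS_ge.
Qed.

Lemma ibS_iter_kernel_op Q n h :
  increasing_kernel Q -> ibS h -> ibS (iter n (kernel_op Q) h).
Proof. by move=> /increasing_kernelP iQ ih; elim: n => //= n; exact: iQ. Qed.

Lemma increasing_poisson r Q t : increasing_kernel Q ->
  increasing_kernel (poisson_semigroup r Q t).
Proof.
move=> iQ; apply: increasing_kernel_ge0 => h ih h0 x y xy.
have bh := ibS_bounded_measurable ih.
rewrite -lee_fin !kernel_op_poisson//; apply: lee_nneseries => k _.
  by move=> _; rewrite lee_fin mulr_ge0 ?poisson_weight_ge0// iter_kernel_op_ge0.
rewrite lee_fin ler_wpM2l ?poisson_weight_ge0//.
by case: (ibS_iter_kernel_op k iQ ih) => _ + _; exact.
Qed.

(** Increasing functions are bounded below by h (wmin wbar) and above by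
    h (wmax wbar), so their oscillation is the difference of these values. *)
Definition contracts_oscillation Q (r : R) : Prop := forall h, ibS h ->
  kernel_op Q h (wmax wbar) - kernel_op Q h (wmin wbar) <=
  r * (h (wmax wbar) - h (wmin wbar)).

(** From the top, a mass k falls below w, where h is at most h w; from the
    bottom, a mass k rises above w, where h is at least h w. The two means of h
    both contain k * h w, which cancels. *)
Lemma mixing_contracts_oscillation Q (w : S) (k : R) :
  (k%:E <= Q (wmax wbar) `[wmin wbar, w]%classic)%E ->
  (k%:E <= Q (wmin wbar) `[w, wmax wbar]%classic)%E ->
  contracts_oscillation Q (1 - k).
Proof.
rewrite itv_wminE itv_wmaxE.
set A := (A in Q _ A); set B := [set x | _ <= _] => kA kB h ih.
have mA : measurable A by apply: measurableC; exact: measurable_above.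
have mB : measurable B by exact: measurable_wage_ge.
have bh := ibS_bounded_measurable ih.
have finE x C : measurable C -> (k%:E <= Q x C)%E -> k <= fine (Q x C).
  move=> mC kC; rewrite -lee_fin fineK// ge0_fin_numE//.
  apply: (le_lt_trans _ (ltry 1)); apply: le_trans (sprob_kernel_le1 Q x).
  by apply: le_measure; rewrite ?inE.
have top : kernel_op Q h (wmax wbar) <=
    (h w - h (wmax wbar)) * fine (Q (wmax wbar) A) + h (wmax wbar).
  rewrite -kernel_op_indic// -[leRHS]/((fun x => _ * kernel_op Q \1_A x + _) _).
  rewrite -kernel_op_affine; last exact: bounded_measurable_indic.
  (* h is below the step function equal to h w on A and to its maximum off A *)
  apply: le_kernel_op => //.
    exact/bounded_measurable_affine/bounded_measurable_indic.
  move=> y; rewrite indicE; have [/set_mem Ay|_] := boolP (y \in A).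
    rewrite mulr1 subrK; have [_ hh _] := ih; apply: hh.
    by rewrite leNgt; apply/negP.
  by rewrite mulr0 add0r ibS_le.
have bot : (h w - h (wmin wbar)) * fine (Q (wmin wbar) B) + h (wmin wbar) <=
    kernel_op Q h (wmin wbar).
  rewrite -kernel_op_indic// -[leLHS]/((fun x => _ * kernel_op Q \1_B x + _) _).
  rewrite -kernel_op_affine; last exact: bounded_measurable_indic.
  apply: le_kernel_op => //.
    exact/bounded_measurable_affine/bounded_measurable_indic.
  move=> y; rewrite indicE; have [/set_mem By|_] := boolP (y \in B).
    by rewrite mulr1 subrK; have [_ hh _] := ih; apply: hh.
  by rewrite mulr0 add0r ibS_ge.
have := finE _ _ mA kA; have := finE _ _ mB kB.
have := ibS_ge w ih; have := ibS_le w ih.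
move: top bot; set p := fine _; set q := fine _.
set hw := h w; set hM := h (wmax _); set hm := h (wmin _).
move=> top bot hwM hmw kq kp.
have : (hM - hw) * k <= (hM - hw) * p by rewrite ler_wpM2l// subr_ge0.
have : (hw - hm) * k <= (hw - hm) * q by rewrite ler_wpM2l// subr_ge0.
by nra.
Qed.

Lemma iter_contracts_oscillation Q r m h :
  increasing_kernel Q -> contracts_oscillation Q r -> 0 <= r -> ibS h ->
  iter m (kernel_op Q) h (wmax wbar) - iter m (kernel_op Q) h (wmin wbar) <=
  r ^+ m * (h (wmax wbar) - h (wmin wbar)).
Proof.
move=> iQ cQ r0 ih; elim: m => [|m IHm]; first by rewrite expr0 mul1r.
rewrite [in leLHS]iterS (le_trans (cQ _ (ibS_iter_kernel_op m iQ ih)))//.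
by rewrite exprS -mulrA ler_wpM2l.
Qed.

(** The mean of an increasing function lies between its values at the two
    ends. *)
Lemma dist_mean_le_oscillation (m m' : {measure set S -> \bar R}) h :
  m setT = 1%E -> m' setT = 1%E -> ibS h ->
  `|\int[m]_x h x - \int[m']_x h x| <= h (wmax wbar) - h (wmin wbar).
Proof.
move=> mT mT' ih; have bh := ibS_bounded_measurable ih.
have := mean_le mT bh (fun x => ibS_le x ih).
have := mean_ge mT bh (fun x => ibS_ge x ih).
have := mean_le mT' bh (fun x => ibS_le x ih).
have := mean_ge mT' bh (fun x => ibS_ge x ih).
by move=> *; rewrite ler_norml; apply/andP; split; lra.
Qed.

End increasing_functions.
(** * The kernels of the wage process *)

Section wage_kernels.
Context {R : realType} {wbar : {posnum R}}.
Local Notation S := (wage_space wbar).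
Implicit Types (h : S -> R) (Q Qu Qe : R.-pker S ~> S).
Implicit Types (delta lambda : {posnum R}).

Lemma bounded_measurable_max h (w : S) :
  bounded_measurable h -> bounded_measurable (fun y => h (Num.max w y)).
Proof.
move=> [mh [M hM]]; split; last by exists M.
apply: measurableT_comp => //.
exact: (measurableT_comp (@measurable_wage_max R wbar) (measurable_pair1 w)).
Qed.

Lemma kernel_op_offer Q h (w : S) : bounded_measurable h ->
  kernel_op (offer_kernel Q) h w = \int[Q w]_y h (Num.max w y).
Proof.
have bm := bounded_measurable_max w; move: h.
apply: eq_translation_ge0 => [c h bh|c h bh|h bh h0].
- by rewrite kernel_op_translation.
- by rewrite (mean_translation _ _ (bm _ bh))// prob_kernel.
apply: EFin_inj; rewrite kernel_op_EFin// mean_EFin ?prob_kernel//; last exact: bm.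
have mh : measurable_fun setT (EFin \o h) by apply/measurable_EFinP; case: bh.
rewrite [LHS]integral_kcomp//.
by apply: eq_integral => y _; rewrite [LHS]integral_dirac// diracT mul1e.
Qed.

Lemma ibS_max h (w : S) : ibS h -> ibS (fun y => h (Num.max w y)).
Proof.
move=> ih; apply: ibS_intro.
  exact/bounded_measurable_max/ibS_bounded_measurable.
move=> x y xy; case: ih => _ + _; apply.
by rewrite ge_max !le_max lexx xy orbT.
Qed.

Lemma increasing_offer Q : increasing_kernel Q ->
  increasing_kernel (offer_kernel Q).
Proof.
move=> iQ x y xy h ih; have bh := ibS_bounded_measurable ih.
change (kernel_op (offer_kernel Q) h x <= kernel_op (offer_kernel Q) h y).
rewrite !kernel_op_offer//.
apply: le_trans (iQ _ _ xy _ (ibS_max y ih)).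
apply: le_mean; rewrite ?prob_kernel//; try exact: bounded_measurable_max.
move=> z; case: ih => _ + _; apply.
by rewrite ge_max !le_max xy lexx orbT.
Qed.

(** Keeping the better of the current wage and of the offer does not lower the
    wage. *)
Lemma kernel_op_offer_ge Q h (w : S) : ibS h ->
  kernel_op Q h w <= kernel_op (offer_kernel Q) h w.
Proof.
move=> ih; have bh := ibS_bounded_measurable ih; rewrite kernel_op_offer//.
apply: le_mean; rewrite ?prob_kernel//; first exact: bounded_measurable_max.
by move=> y; case: ih => _ + _; apply; rewrite le_max lexx orbT.
Qed.

Lemma iter_kernel_op_offer_ge Q n h (w : S) : increasing_kernel Q -> ibS h ->
  iter n (kernel_op Q) h w <= iter n (kernel_op (offer_kernel Q)) h w.
Proof.
move=> iQ ih; elim: n w => //= n IHn w.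
apply: (le_trans (kernel_op_offer_ge Q w (ibS_iter_kernel_op n iQ ih))).
apply: le_kernel_op => //.
  exact/bounded_measurable_iter_kernel_op/ibS_bounded_measurable.
exact/bounded_measurable_iter_kernel_op/ibS_bounded_measurable.
Qed.

Lemma kernel_op_jump delta lambda Qu Qe h x : bounded_measurable h ->
  kernel_op (jump_kernel delta lambda Qu Qe) h x =
  delta%:num / (delta%:num + lambda%:num) * kernel_op Qu h x +
  lambda%:num / (delta%:num + lambda%:num) * kernel_op (offer_kernel Qe) h x.
Proof.
move: h; apply: eq_translation_ge0 => [c h bh|c h bh|h bh h0].
- by rewrite kernel_op_translation.
- by rewrite !kernel_op_translation//; field.
have mh : measurable_fun setT (EFin \o h) by apply/measurable_EFinP; case: bh.
apply: EFin_inj; rewrite EFinD !EFinM !kernel_op_EFin//.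
rewrite [LHS]ge0_integral_measure_add//; last by move=> y _; rewrite lee_fin.
by rewrite !ge0_integral_mscale// => y _; rewrite lee_fin.
Qed.

Lemma increasing_jump delta lambda Qu Qe :
  increasing_kernel Qu -> increasing_kernel Qe ->
  increasing_kernel (jump_kernel delta lambda Qu Qe).
Proof.
move=> iu ie x y xy h ih; have bh := ibS_bounded_measurable ih.
change (kernel_op (jump_kernel delta lambda Qu Qe) h x <=
        kernel_op (jump_kernel delta lambda Qu Qe) h y).
rewrite (kernel_op_jump delta lambda Qu Qe x bh).
rewrite (kernel_op_jump delta lambda Qu Qe y bh).
have hu : kernel_op Qu h x <= kernel_op Qu h y := iu x y xy h ih.
have he : kernel_op (offer_kernel Qe) h x <= kernel_op (offer_kernel Qe) h y.
  exact: (increasing_offer ie xy ih).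
by apply: lerD; rewrite ler_pM2l.
Qed.

Lemma iter_kernel_op_ge (K Q : R.-pker S ~> S) (p : R) n h x : 0 <= p ->
  (forall g y, bounded_measurable g -> (forall z, 0 <= g z) ->
    p * kernel_op Q g y <= kernel_op K g y) ->
  bounded_measurable h -> (forall y, 0 <= h y) ->
  p ^+ n * iter n (kernel_op Q) h x <= iter n (kernel_op K) h x.
Proof.
move=> p0 KQ bh h0; elim: n x => [|n IHn] x; first by rewrite expr0 mul1r.
have bQ := bounded_measurable_iter_kernel_op Q n bh.
have bK := bounded_measurable_iter_kernel_op K n bh.
have K0 y : 0 <= iter n (kernel_op K) h y by exact: iter_kernel_op_ge0.
rewrite !iterS; apply: le_trans (KQ _ _ bK K0); rewrite exprS -mulrA ler_wpM2l//.
have := kernel_op_affine Q (p ^+ n) 0 bQ.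
move=> /(congr1 (@^~ x))/=; rewrite addr0 => <-.
apply: le_kernel_op => // [|y]; first exact: bounded_measurable_affine.
by rewrite addr0.
Qed.

Lemma kernel_op_poisson_ge r (Q : R.-pker S ~> S) t n h x :
  bounded_measurable h -> (forall y, 0 <= h y) ->
  poisson_weight r t n * iter n (kernel_op Q) h x <=
  kernel_op (poisson_semigroup r Q t) h x.
Proof.
move=> bh h0.
have F0 k : (0 <= (poisson_weight r t k * iter k (kernel_op Q) h x)%:E)%E.
  by rewrite lee_fin mulr_ge0 ?poisson_weight_ge0// iter_kernel_op_ge0.
rewrite -lee_fin kernel_op_poisson// (@nneseriesD1 _ _ n xpredT)//.
by rewrite leeDl// nneseries_ge0.
Qed.

(** During one unit of time, n jumps occur with probability
    (delta + lambda)^n exp(- (delta + lambda)) / n!, and these are all job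
    destructions (resp. all offers) with probability
    (delta / (delta + lambda))^n (resp. (lambda / (delta + lambda))^n). *)
Lemma wage_semigroup1_mixing delta lambda Qu Qe (what : S) n (eps : R) :
  increasing_kernel Qe -> 0 < eps ->
  (eps%:E <= kpow Qu n (wmax wbar) `[wmin wbar, what]%classic)%E ->
  (eps%:E <= kpow Qe n (wmin wbar) `[what, wmax wbar]%classic)%E ->
  let kappa := expR (- (delta%:num + lambda%:num)) *
    Num.min delta%:num lambda%:num ^+ n / n`!%:R * eps in
  let P1 := wage_semigroup delta lambda Qu Qe 1%:nng in
  (kappa%:E <= P1 (wmax wbar) `[wmin wbar, what]%classic)%E /\
  (kappa%:E <= P1 (wmin wbar) `[what, wmax wbar]%classic)%E.
Proof.
move=> ie eps0; rewrite itv_wminE itv_wmaxE.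
set A := (A in kpow Qu n _ A); set B := [set x | _ <= _] => hA hB kappa P1.
have mA : measurable A by apply: measurableC; exact: measurable_above.
have mB : measurable B by exact: measurable_wage_ge.
pose (r := (delta%:num + lambda%:num)%:pos : {posnum R}); pose a := r%:num.
pose K : R.-pker S ~> S := jump_kernel delta lambda Qu Qe.
have indic0 C (y : S) : 0 <= \1_C y :> R by rewrite indicE.
have kappaE (p : {posnum R}) : Num.min delta%:num lambda%:num <= p%:num ->
    kappa <= poisson_weight r 1%:nng n * ((p%:num / a) ^+ n * eps).
  move=> dp; rewrite /kappa /poisson_weight/= mulr1 [leRHS]mulrA.
  apply: ler_wpM2r; first exact: ltW.
  rewrite expr_div_n -/a !mulrA.
  have -> : expR (- a) * a ^+ n / n`!%:R * p%:num ^+ n / a ^+ n =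
            expR (- a) * p%:num ^+ n / n`!%:R.
    have n0 : n`!%:R != 0 :> R by rewrite pnatr_eq0 -lt0n fact_gt0.
    have a0 : a ^+ n != 0 by rewrite expf_neq0// /a.
    by move: (a ^+ n) a0 => an a0; field; rewrite n0 a0.
  rewrite ler_wpM2r// ler_wpM2l ?expR_ge0// lerXn2r// nnegrE//.
have finE (Q : R.-pker S ~> S) x C q : measurable C ->
    (q%:E <= Q x C)%E <-> q <= kernel_op Q \1_C x.
  by move=> mC; rewrite -lee_fin kernel_op_EFin ?integral_indic ?setIT//;
    exact: bounded_measurable_indic.
have P1_ge (p : {posnum R}) (Q : R.-pker S ~> S) x C : measurable C ->
    Num.min delta%:num lambda%:num <= p%:num ->
    (forall g y, bounded_measurable g -> (forall z, 0 <= g z) ->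
      p%:num / a * kernel_op Q g y <= kernel_op K g y) ->
    eps <= iter n (kernel_op Q) \1_C x -> (kappa%:E <= P1 x C)%E.
  move=> mC dp KQ epsQ; apply/finE => //. apply: (le_trans (kappaE _ dp)).
  have bC : bounded_measurable (\1_C : S -> R) by exact: bounded_measurable_indic.
  apply: le_trans (kernel_op_poisson_ge r K 1%:nng n x bC (indic0 C)).
  rewrite ler_wpM2l ?poisson_weight_ge0//.
  have pa0 : 0 <= p%:num / a by rewrite /a.
  apply: le_trans (iter_kernel_op_ge n x pa0 KQ bC (indic0 C)).
  by rewrite ler_wpM2l// exprn_ge0.
have kop0 (Q : R.-pker S ~> S) g y : bounded_measurable g ->
    (forall z, 0 <= g z) -> 0 <= kernel_op Q g y by exact: kernel_op_ge.
split.
- apply: (P1_ge delta Qu) => //; first by rewrite ge_min lexx.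
    by move=> g y bg g0; rewrite kernel_op_jump// lerDl mulr_ge0// kop0.
  by rewrite -kernel_op_kpow; [exact/finE|exact: bounded_measurable_indic].
- apply: (P1_ge lambda (offer_kernel Qe)) => //; first by rewrite ge_min lexx orbT.
    by move=> g y bg g0; rewrite kernel_op_jump// lerDr mulr_ge0// kop0.
  apply: le_trans (iter_kernel_op_offer_ge _ _ ie _).
    by rewrite -kernel_op_kpow; [exact/finE|exact: bounded_measurable_indic].
  by apply: ibS_indic => // x y xy /le_trans; apply.
Qed.

End wage_kernels.
(** * Upper rays determine the means of increasing functions *)

Section stochastic_order.
Context {R : realType} {wbar : {posnum R}}.
Local Notation S := (wage_space wbar).
Implicit Types (h : S -> R) (phi psi : probability S R).

(** A nonempty upper set is an open or a closed upper ray, according to whether its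
    infimum is attained; a closed ray is a decreasing limit of open ones. *)
Lemma upper_set_measure_le phi psi (e : R) (U : set S) : 0 <= e ->
  (forall r : R, phi (above r) <= psi (above r) + e%:E)%E ->
  measurable U -> (forall x y, x <= y -> U x -> U y) ->
  (phi U <= psi U + e%:E)%E.
Proof.
move=> e0 phipsi mU upU.
have [->|/set0P[x0 Ux0]] := eqVneq U set0.
  by rewrite !measure0 add0e lee_fin.
pose V : set R := val @` U; pose c := inf V.
have hV : has_inf V.
  split; first by exists (val x0), x0.
  by exists 0 => _ [x _ <-]; exact: (wmin_le x).
have cV x : U x -> c <= val x.
  by move=> Ux; apply: ge_inf; [case: hV|exists x].
have [[x1 Ux1 x1c]|Uc] := pselect (exists2 x, U x & val x = c); last first.
  suff -> : U = above c by exact: phipsi.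
  rewrite /above; apply/seteqP; split => [x Ux|x cx] /=.
    by rewrite lt_neqAle cV// andbT; apply/eqP => cx; apply: Uc; exists x.
  have [_ [y Uy <-] yx] := inf_lt hV.1 cx.
  exact: upU (ltW yx) Uy.
pose W : set S := [set x | c <= val x].
have -> : U = W.
  apply/seteqP; split => [x Ux|x cx] /=; first exact: cV.
  by apply: upU Ux1; move: cx; rewrite /W/= -x1c.
pose F (k : nat) : set S := above (c - k.+1%:R^-1).
have FE : \bigcap_k F k = W.
  apply/seteqP; split => [x Fx|x cx k _] /=; last first.
    by rewrite /F/above/=; apply: (lt_le_trans _ cx); rewrite ltrBlDr ltrDl invr_gt0.
  rewrite /W/= leNgt; apply/negP => xc.
  have [k kc] := ltr_add_invr xc.
  by have := Fx k I; rewrite /F/above/= ltrBlDr ltNge (ltW kc).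
have mF k : measurable (F k) by exact: measurable_above.
have cvF : (psi \o F) k + e%:E @[k --> \oo] --> (psi W + e%:E)%E.
  apply: cvgeD; [exact: fin_num_adde_defl|rewrite -FE|exact: cvg_cst].
  apply: nonincreasing_cvg_mu => //.
  - by rewrite (le_lt_trans (probability_le1 _ _)) ?ltry.
  - by rewrite FE; exact: measurable_wage_ge.
  - move=> m n mn; rewrite /F/above; apply/subsetPset => x /=; apply: le_lt_trans.
    by rewrite lerD2l lerN2 lef_pV2 ?posrE// ler_nat.
rewrite -(cvg_lim _ cvF)//; apply: lime_ge; first by apply/cvg_ex; eexists; exact: cvF.
apply: nearW => k; apply: le_trans (phipsi _).
apply: le_measure; rewrite ?inE//; first exact: measurable_wage_ge.
  exact: measurable_above.
by rewrite /above => x /=; apply: lt_le_trans; rewrite ltrBlDr ltrDl invr_gt0.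
Qed.

(** By the layer cake formula, the mean of h - h (wmin wbar) is the integral over
    r >= 0 of the probabilities of its level sets, which are upper sets, and
    empty beyond the oscillation of h. *)
Lemma mean_le_of_upper_rays phi psi (e : R) h : 0 <= e ->
  (forall r : R, phi (above r) <= psi (above r) + e%:E)%E ->
  ibS h ->
  \int[phi]_x h x <= \int[psi]_x h x + e * (h (wmax wbar) - h (wmin wbar)).
Proof.
move=> e0 phipsi ih; pose M := h (wmax wbar) - h (wmin wbar).
have M0 : 0 <= M by rewrite subr_ge0 ibS_ge.
pose g x := h x + (- h (wmin wbar)).
have ig : ibS g by exact: ibS_translation.
have bg := ibS_bounded_measurable ig.
have g0 x : 0 <= g x by rewrite subr_ge0 ibS_ge.
have [mg _] := bg.
pose X : {mfun S >-> R} := HB.pack g (isMeasurableFun.Build _ _ _ _ g mg).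
suff : \int[phi]_x g x <= \int[psi]_x g x + e * M.
  have bh := ibS_bounded_measurable ih.
  rewrite (mean_translation (probability_setT phi))//.
  rewrite (mean_translation (probability_setT psi))//.
  by rewrite addrAC lerD2r.
rewrite -lee_fin EFinD (mean_EFin (probability_setT phi) bg).
rewrite (mean_EFin (probability_setT psi) bg).
have -> : (\int[phi]_x (g x)%:E = 'E_phi[X])%E by rewrite expectation_def.
have -> : (\int[psi]_x (g x)%:E = 'E_psi[X])%E by rewrite expectation_def.
rewrite !ge0_expectation_ccdf//.
set D := `[0, +oo[%classic; set mu := lebesgue_measure.
have mD : measurable D by exact: measurable_itv.
have -> : (e * M)%:E = (\int[mu]_(r in D) (e * \1_(`[0, M]%classic) r)%:E)%E.
  rewrite integralZl_indic//; last by move=> e0'; move: e0; rewrite leNgt e0'.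
  rewrite integral_indic//= setIidl; last by apply: subset_itvl; rewrite bnd_simp.
  rewrite lebesgue_measure_itv/= lte_fin.
  have [_|Mle0] := ltP 0 M; first by rewrite sube0 EFinM.
  have -> : M = 0 by apply/le_anti; rewrite M0 Mle0.
  by rewrite mulr0 mule0.
have me : measurable_fun D (fun r => (e * \1_(`[0, M]%classic) r)%:E).
  by apply/measurable_EFinP; apply: measurable_funM => //; exact: measurable_indic.
rewrite -ge0_integralD//; first last.
- by move=> r _; rewrite lee_fin mulr_ge0// indicE.
- by apply: measurable_funTS; exact: ccdf_measurable.
apply: ge0_le_integral => //.
- by apply: measurable_funTS; exact: ccdf_measurable.
- by apply: emeasurable_funD => //; apply: measurable_funTS; exact: ccdf_measurable.
move=> r; rewrite /D/= in_itv/= andbT => r0.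
have [rM|Mr] := leP r M.
  rewrite indicE mem_set/=; last by rewrite in_itv/= r0 rM.
  rewrite mulr1; apply: upper_set_measure_le => //.
    by rewrite -[X in measurable X]setTI; exact: (mg measurableT _ (measurable_itv _)).
  move=> x y xy /=; rewrite !in_itv/= !andbT => /lt_le_trans; apply.
  by case: ig => _ + _; exact.
rewrite /ccdf /distribution /pushforward.
have -> : X @^-1` `]r, +oo[%classic = set0; last first.
  by rewrite measure0 adde_ge0// lee_fin mulr_ge0// indicE.
apply/seteqP; split => // x /=; rewrite in_itv/= andbT => /(lt_trans Mr).
by rewrite ltNge lerD2r ibS_le.
Qed.

Lemma dist_mean_le_of_upper_rays phi psi (e : R) h : 0 <= e ->
  (forall r : R, `|fine (phi (above r)) -
                   fine (psi (above r))| <= e) ->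
  ibS h ->
  `|\int[phi]_x h x - \int[psi]_x h x| <=
  e * (h (wmax wbar) - h (wmin wbar)).
Proof.
move=> e0 phipsi ih.
have rays (m m' : probability S R) : (forall r : R,
      fine (m (above r)) <= fine (m' (above r)) + e) ->
    forall r : R, (m (above r) <= m' (above r) + e%:E)%E.
  move=> mm' r; have mr : measurable (above r : set S) := measurable_above r.
  rewrite -(fineK (fin_num_measure m _ mr)) -(fineK (fin_num_measure m' _ mr)).
  by rewrite -EFinD lee_fin; exact: mm'.
have le1 := mean_le_of_upper_rays e0 (rays phi psi _) ih.
have le2 := mean_le_of_upper_rays e0 (rays psi phi _) ih.
rewrite ler_distl lerBlDr; apply/andP; split; [apply: le2|apply: le1] => r;
  have := phipsi r; rewrite ler_distl lerBlDr => /andP[]//.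
Qed.

Lemma eq_probability_upper_rays phi psi :
  (forall r : R, phi (above r) = psi (above r)) ->
  forall B, measurable B -> phi B = psi B.
Proof.
move=> phipsi B; rewrite measurable_wage_spaceE => -[C mC <-]; rewrite setTI.
pose v : {mfun S >-> R} := HB.pack (val : S -> R)
  (isMeasurableFun.Build _ _ _ _ _ (@measurable_wage_val R wbar)).
change (distribution phi v C = distribution psi v C).
apply: (measure_unique (@RGenOInfty.G R) (fun k => `]- k%:R, +oo[%classic)) => //.
- exact: RGenOInfty.measurableE.
- move=> _ _ [a ->] [b ->]; exists (Num.max a b); apply/seteqP; split => x /=.
    by rewrite !in_itv/= !andbT gt_max => -[-> ->].
  by rewrite !in_itv/= !andbT gt_max => /andP[].
- by move=> k; exists (- k%:R).
- apply/seteqP; split => // x _; exists (Num.truncn `|x|).+1 => //=.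
  rewrite in_itv/= andbT ltrNl (le_lt_trans _ (truncnS_gt _))//.
  by rewrite -normrN ler_norm.
- move=> _ [a ->].
  change (phi (v @^-1` `]a, +oo[%classic) = psi (v @^-1` `]a, +oo[%classic)).
  rewrite (_ : v @^-1` _ = above a); first exact: phipsi.
  by rewrite /above; apply/seteqP; split => x /=; rewrite in_itv/= andbT.
- by move=> k; rewrite (le_lt_trans (probability_le1 _ _)) ?ltry.
Qed.

(** The law is the image of the Lebesgue-Stieltjes measure of F, which is
    concentrated on the interval from 0 to wbar, by the retraction of the line
    onto this interval. *)
Lemma exists_probability_cdf (F : R -> R) :
  {homo F : x y / x <= y} ->
  (forall a, F r @[r --> a^'+] --> F a) ->
  (forall r, r < 0 -> F r = 0) -> (forall r, wbar%:num <= r -> F r = 1) ->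
  exists phi, forall r : R, phi (above r) = (1 - F r)%:E.
Proof.
move=> ndF rcF F0 F1.
have FNy : F @ -oo --> (0 : R).
  apply: cvg_near_cst; near=> r; apply: F0; near: r; exact: nbhs_ninfty_lt.
have Fy : F @ +oo --> (1 : R).
  apply: cvg_near_cst; near=> r; apply: F1; near: r; exact: nbhs_pinfty_ge.
pose F' : cumulativeBounded (0 : R) (1 : R) := HB.pack F
  (isCumulative.Build R _ R F ndF rcF)
  (isCumulativeBounded.Build R 0 1 F FNy Fy).
pose retr (x : R) : R := Num.max 0 (Num.min x wbar%:num).
have retrP x : retr x \in `[0, wbar%:num]%classic.
  by rewrite inE/= in_itv/= /retr le_max lexx/= ge_max ge_min lexx orbT ge0.
pose p (x : R) : S := Sub (retr x) (retrP x).
have mp : measurable_fun setT (p : measurableTypeR R -> S).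
  move=> _ B; rewrite measurable_wage_spaceE => -[C mC <-]; rewrite !setTI.
  have mr : measurable_fun setT retr.
    by apply: measurable_maxr => //; exact: measurable_minr.
  by have := mr measurableT C mC; rewrite setTI.
pose X : {mfun measurableTypeR R >-> S} := HB.pack p
  (isMeasurableFun.Build _ _ (measurableTypeR R) S p mp).
pose mu : probability (measurableTypeR R) R := lebesgue_stieltjes_measure F'.
exists (distribution mu X) => r.
change (mu (p @^-1` above r) = (1 - F r)%:E).
have muE : mu `]-oo, r]%classic = (F r)%:E.
  by have := cdf_lebesgue_stieltjes_id F' r.
have [r0|r0] := ltP r 0.
  have -> : p @^-1` above r = setT; last by rewrite probability_setT F0// subr0.
  apply/seteqP; split => // x _; apply: (lt_le_trans r0).
  by rewrite /retr le_max lexx.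
have [wr|rw] := leP wbar%:num r.
  have -> : p @^-1` above r = set0; last by rewrite measure0 F1// subrr.
  apply/seteqP; split => // x /=; apply/negP; rewrite -leNgt.
  by rewrite /retr ge_max r0/= ge_min wr orbT.
have -> : p @^-1` above r = ~` `]-oo, r]%classic.
  apply/seteqP; split => x /=; rewrite /above/= /retr in_itv/= lt_max lt_min rw andbT.
    by rewrite (ltNge r 0) r0/= => rx; apply/negP; rewrite -ltNge.
  by move/negP; rewrite -ltNge => ->; rewrite orbT.
by rewrite probability_setC// muE EFinB.
Unshelve. all: by end_near. Qed.

End stochastic_order.
(** * Invariant distributions of contracting kernels *)

Section contracting_kernel.
Context {R : realType} {wbar : {posnum R}}.
Local Notation S := (wage_space wbar).
Implicit Types (h : S -> R) (phi psi : probability S R).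

Lemma eq_probability_means phi psi :
  (forall h, bounded_measurable h -> \int[phi]_x h x = \int[psi]_x h x) ->
  forall B, measurable B -> phi B = psi B.
Proof.
move=> phipsi B mB; have := phipsi _ (bounded_measurable_indic R mB).
rewrite !mean_indic// => eB.
by rewrite -(fineK (fin_num_measure phi _ mB)) eB fineK// fin_num_measure.
Qed.

Variable Q : R.-pker S ~> S.

Lemma mean_invariant phi h :
  (forall B, measurable B -> kact phi Q B = phi B) -> bounded_measurable h ->
  \int[phi]_x kernel_op Q h x = \int[phi]_x h x.
Proof.
move=> sphi bh; rewrite -mean_kact//; congr fine.
by apply: eq_measure_integral => B mB _; exact: sphi.
Qed.

Variable rho : R.
Hypotheses (incrQ : increasing_kernel Q) (contrQ : contracts_oscillation Q rho).
Hypotheses (rho0 : 0 <= rho) (rho1 : rho < 1).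

Let iter_ibS m h : ibS h -> ibS (iter m (kernel_op Q) h).
Proof. exact: ibS_iter_kernel_op. Qed.

(** Under two invariant laws, the means of an increasing function differ by at
    most the oscillation of its m-th iterate, for every m. *)
Lemma contracting_invariant_unique phi psi :
  (forall B, measurable B -> kact phi Q B = phi B) ->
  (forall B, measurable B -> kact psi Q B = psi B) ->
  forall B, measurable B -> phi B = psi B.
Proof.
move=> sphi spsi; apply: eq_probability_upper_rays => r.
pose h : S -> R := \1_(above r); have mr : measurable (above r : set S).
  exact: measurable_above.
have ih : ibS h by apply: ibS_indic => // x y xy /lt_le_trans; exact.
have invE chi m : (forall B, measurable B -> kact chi Q B = chi B) ->
    \int[chi]_x iter m (kernel_op Q) h x = \int[chi]_x h x.
  move=> schi; elim: m => //= m <-; apply: mean_invariant => //.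
  exact/bounded_measurable_iter_kernel_op/ibS_bounded_measurable.
suff : \int[phi]_x h x = \int[psi]_x h x.
  rewrite !mean_indic// => eB.
  by rewrite -(fineK (fin_num_measure phi _ mr)) eB fineK// fin_num_measure.
pose osc := h (wmax wbar) - h (wmin wbar).
have cv0 : rho ^+ m * osc @[m --> \oo] --> (0 : R).
  rewrite -[X in _ --> X](mul0r osc); apply: cvgMl.
  by apply: cvg_expr; rewrite ger0_norm.
apply/eqP; rewrite -subr_eq0 -normr_le0.
rewrite -(cvg_lim _ cv0)//; apply: limr_ge; first by apply/cvg_ex; eexists; exact: cv0.
apply: nearW => m; rewrite -(invE phi m sphi) -(invE psi m spsi).
apply: le_trans (iter_contracts_oscillation m incrQ contrQ rho0 ih).
exact: (dist_mean_le_oscillation (probability_setT phi) (probability_setT psi)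
  (iter_ibS m ih)).
Qed.

(** The laws of the chain started from the bottom converge: the contraction of
    oscillations makes the probabilities of upper rays uniformly Cauchy, and a
    uniform limit of distribution functions is a distribution function. *)
Lemma contracting_invariant_exists :
  exists phi, forall B, measurable B -> kact phi Q B = phi B.
Proof.
pose u h m := iter m (kernel_op Q) h (wmin wbar).
pose osc h := h (wmax wbar) - h (wmin wbar).
(* the start is the lowest point, so the law stochastically increases *)
have u_nd h : ibS h -> {homo u h : m k / (m <= k)%N >-> m <= k}.
  move=> ih; apply/nondecreasing_seqP => m; rewrite /u iterS.
  have iu := iter_ibS m ih; apply: kernel_op_ge => [|y]; last exact: ibS_ge.
  exact: ibS_bounded_measurable.
(* for m <= k, u h m and u h k are averages of values of the m-th iterate of h *)
have u_le h m k : ibS h -> u h k <= u h m + rho ^+ m * osc h.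
  move=> ih; have [km|mk] := leP k m.
    rewrite (le_trans (u_nd h ih _ _ km))// lerDl mulr_ge0 ?exprn_ge0//.
    by rewrite subr_ge0 ibS_ge.
  rewrite -lerBlDl.
  apply: le_trans (iter_contracts_oscillation m incrQ contrQ rho0 ih).
  rewrite lerD2r /u -(subnK (ltnW mk)) iterD -kernel_op_kpow; last first.
    exact/ibS_bounded_measurable/iter_ibS.
  have iu := iter_ibS m ih; apply: kernel_op_le => [|y]; last exact: ibS_le.
  exact: ibS_bounded_measurable.
pose ray r : S -> R := \1_(above r).
have mr r : measurable (above r : set S) by exact: measurable_above.
have iray r : ibS (ray r) by apply: ibS_indic => // x y xy /lt_le_trans; exact.
have osc_ray r m : rho ^+ m * osc (ray r) <= rho ^+ m.
  rewrite ler_piMr ?exprn_ge0// /osc /ray !indicE.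
  by do 2 case: (_ \in _) => /=; lra.
pose L r := limn (u (ray r)).
have cvL r : cvgn (u (ray r)).
  apply: nondecreasing_is_cvgn; first exact: u_nd.
  by exists (u (ray r) 0%N + rho ^+ 0 * osc (ray r)) => _ [k _ <-]; exact: u_le.
have uL r m : u (ray r) m <= L r by apply: nondecreasing_cvgn_le => //; exact: u_nd.
have Lu r m : L r <= u (ray r) m + rho ^+ m.
  apply: limr_le => //; apply: nearW => k.
  by rewrite (le_trans (u_le _ m k _))// lerD2l.
pose law m : probability S R :=
  total_mass1 (@prob_kernel _ _ _ _ _ (kpow Q m) (wmin wbar)).
have uE h m : ibS h -> \int[law m]_x h x = u h m.
  by move=> ih; rewrite /u -kernel_op_kpow//; exact: ibS_bounded_measurable.
have u_ray r m : u (ray r) m = fine (law m (above r)).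
  by rewrite -uE// mean_indic.
pose F r := 1 - L r.
have ndF : {homo F : r s / r <= s}.
  move=> r s rs; rewrite lerD2l lerN2; apply: ler_lim => //; apply: nearW => m.
  rewrite !u_ray fine_le ?fin_num_measure//; apply: le_measure; rewrite ?inE//.
  by move=> x; exact: le_lt_trans.
pose v : {mfun S >-> R} := HB.pack (val : S -> R)
  (isMeasurableFun.Build _ _ _ _ _ (@measurable_wage_val R wbar)).
have rc_law m a : fine (law m (above r)) @[r --> a^'+] --> fine (law m (above a)).
  have lawE r : law m (above r) = @ccdf _ _ _ (law m) v r.
    rewrite /ccdf /distribution /pushforward; congr (law m _).
    by rewrite /above; apply/seteqP; split => x /=; rewrite in_itv/= andbT.
  under eq_fun do rewrite lawE; rewrite lawE; apply: fine_cvg.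
  rewrite fineK; last by rewrite -lawE fin_num_measure.
  exact: ccdf_right_continuous.
have cv_rho c : rho ^+ m * c @[m --> \oo] --> (0 : R).
  rewrite -[X in _ --> X](mul0r c); apply: cvgMl.
  by apply: cvg_expr; rewrite ger0_norm.
have [||r r0|r wr|phi phiE] := @exists_probability_cdf R wbar F.
- exact: ndF.
- move=> a; apply/cvgrPdist_le => e e0; have e20 : 0 < e / 2 by rewrite divr_gt0.
  have [m rhom] : exists m, rho ^+ m <= e / 2.
    have /cvgrPdist_le/(_ _ e20)[m _ /(_ m (leqnn m))/=] := cv_rho 1.
    by rewrite mulr1 sub0r normrN ger0_norm ?exprn_ge0//; exists m.
  have /cvgrPdist_le/(_ _ e20) := rc_law m a.
  rewrite -u_ray => cva; near=> r.
  have ar : a <= r by near: r; exact: nbhs_right_ge.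
  rewrite distrC ger0_norm; last by rewrite subr_ge0 ndF.
  have : `|u (ray a) m - u (ray r) m| <= e / 2 by rewrite [u (ray r) m]u_ray; near: r.
  rewrite ler_norml => /andP[_]; have := uL r m; have := Lu a m.
  by rewrite /F; lra.
- have -> : F r = 1 - 1; last by rewrite subrr.
  congr (1 - _); apply/cvg_lim => //; apply: cvg_near_cst; apply: nearW => m.
  rewrite u_ray (_ : above r = setT) ?probability_setT//.
  apply/seteqP; split => // x _; apply: (lt_le_trans r0).
  exact: (wmin_le x).
- have -> : F r = 1 - 0; last by rewrite subr0.
  congr (1 - _); apply/cvg_lim => //; apply: cvg_near_cst; apply: nearW => m.
  rewrite u_ray (_ : above r = set0) ?measure0//.
  apply/seteqP; split => // x; rewrite /above/=; apply/negP; rewrite -leNgt.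
  have xw : val x <= wbar%:num := le_wmax x.
  exact: le_trans xw wr.
have phi_law m h : ibS h ->
    `|\int[law m]_x h x - \int[phi]_x h x| <= rho ^+ m * osc h.
  move=> ih; apply: dist_mean_le_of_upper_rays => //; first exact: exprn_ge0.
  move=> r; rewrite -u_ray phiE /F/= subKr distrC ger0_norm ?subr_ge0//.
  by rewrite lerBlDl.
have cv h : ibS h -> u h m @[m --> \oo] --> \int[phi]_x h x.
  move=> ih; apply/subr_cvg0/norm_cvg0P.
  apply: (@squeeze_cvgr _ _ _ _ (fun=> 0) (fun m => rho ^+ m * osc h)).
  - by apply: nearW => m; rewrite normr_ge0/= -uE// phi_law.
  - exact: cvg_cst.
  - exact: cv_rho.
exists phi; apply: eq_probability_upper_rays => r.
rewrite -(fineK (fin_num_measure _ _ (mr r))).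
rewrite -[in RHS](fineK (fin_num_measure _ _ (mr r))).
rewrite -!mean_indic// mean_kact; last exact: bounded_measurable_indic.
have iQ : ibS (kernel_op Q (ray r)) by exact: (iter_ibS 1 (iray r)).
have uS : u (kernel_op Q (ray r)) = (fun m => u (ray r) m.+1).
  by apply/funext => m; rewrite /u -iterSr.
have := cv _ iQ; rewrite uS (cvg_shiftS (u (ray r))) => cvQ.
by congr EFin; apply: (cvg_unique _ cvQ (cv _ (iray r))).
Unshelve. all: by end_near. Qed.

End contracting_kernel.
(** * Stability of the wage process *)

Section beta_distance.
Context {R : realType} {wbar : {posnum R}}.
Local Notation S := (wage_space wbar).
Implicit Types (phi psi : probability S R).

Lemma oscillation_le2 (h : S -> R) x y :
  (forall z, `|h z| <= 1) -> h x - h y <= 2.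
Proof.
by move=> h1; have := h1 x; have := h1 y;
  rewrite !ler_norml => /andP[? ?] /andP[? ?]; lra.
Qed.

Lemma beta_le phi psi (b : R) :
  (forall h, ibS h -> (forall x, `|h x| <= 1) ->
    `|\int[phi]_x h x - \int[psi]_x h x| <= b) -> beta phi psi <= b.
Proof.
move=> hb; apply: ge_sup; last by move=> _ [h [ih h1] <-]; exact: hb.
exists `|\int[phi]_x (0 : R) - \int[psi]_x (0 : R)|, (fun=> 0) => //.
by split; [split => //; exists 0|]; move=> *; rewrite normr0.
Qed.

Lemma beta_ge0 phi psi : 0 <= beta phi psi.
Proof.
apply: sup_upper_bound.
  split; first by exists `|\int[phi]_x (0 : R) - \int[psi]_x (0 : R)|,
    (fun=> 0) => //; split; [split => //; exists 0|]; move=> *; rewrite normr0.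
  exists 2 => _ [h [ih h1] <-].
  apply: le_trans (dist_mean_le_oscillation (probability_setT phi)
    (probability_setT psi) ih) _.
  exact: oscillation_le2.
exists (fun=> 0); last by rewrite (mean_cst (probability_setT phi))
  (mean_cst (probability_setT psi)) subrr normr0.
by split; [split => //; exists 0|]; move=> *; rewrite normr0.
Qed.

End beta_distance.

Section wage_stability.
Context {R : realType} {wbar : {posnum R}}.
Local Notation S := (wage_space wbar).
Implicit Types (h : S -> R) (phi psi : probability S R).

Lemma poisson_weight_le1 (r : {posnum R}) t k : poisson_weight r t k <= 1.
Proof.
rewrite -lee_fin -(sum_poisson_weight r t) (@nneseriesD1 _ _ k xpredT)//.
  rewrite leeDl// nneseries_ge0// => j _ _.
  by rewrite lee_fin poisson_weight_ge0.
by move=> j _; rewrite lee_fin poisson_weight_ge0.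
Qed.

(** Strictness makes the contraction effective: the minimum of the two rates is
    less than their sum a, and a^n exp (- a) / n! is a probability. *)
Lemma kappa_lt1 (delta lambda : {posnum R}) n (eps : R) : (0 < n)%N ->
  eps <= 1 ->
  expR (- (delta%:num + lambda%:num)) *
    Num.min delta%:num lambda%:num ^+ n / n`!%:R * eps < 1.
Proof.
move=> n0 eps1; set m := Num.min _ _; pose a := delta%:num + lambda%:num.
have m0 : 0 < m by rewrite lt_min !gt0.
have ma : m < a by rewrite gt_min ltrDl gt0.
have f0 : 0 < n`!%:R :> R by rewrite ltr0n fact_gt0.
have w1 : poisson_weight (delta%:num + lambda%:num)%:pos 1%:nng n <= 1.
  exact: poisson_weight_le1.
rewrite /poisson_weight/= mulr1 -/a in w1.
apply: (@le_lt_trans _ _ (expR (- a) * m ^+ n / n`!%:R)).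
  rewrite ler_piMr// mulr_ge0 ?invr_ge0 ?ler0n// mulr_ge0 ?expR_ge0//.
  by rewrite exprn_ge0// ltW.
apply: (lt_le_trans _ w1); rewrite ltr_pM2r ?invr_gt0// ltr_pM2l ?expR_gt0//.
by rewrite ltrXn2r -?lt0n// ?nnegrE ltW.
Qed.

Section semigroup.
Variables (r : {posnum R}) (Q : R.-pker S ~> S) (rho : R).
Local Notation P := (poisson_semigroup r Q).
Hypotheses (incrQ : increasing_kernel Q).
Hypotheses (contrP1 : contracts_oscillation (P 1%:nng) rho).
Hypotheses (rho0 : 0 <= rho) (rho1 : rho < 1).

Let P1 : R.-pker S ~> S := P 1%:nng.

Let incrP t : increasing_kernel (P t).
Proof. exact: increasing_poisson. Qed.

Let bP t h : bounded_measurable h -> bounded_measurable (kernel_op (P t) h).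
Proof. exact: bounded_measurable_kernel_op. Qed.

(** Since the operators of the semigroup commute, each of them maps the
    invariant distribution at time 1 to an invariant distribution at time 1,
    hence to itself. *)
Lemma stationary_exists : exists phi, stationary P phi.
Proof.
have [phi sphi] := contracting_invariant_exists (incrP 1%:nng) contrP1 rho0 rho1.
exists phi => t.
apply: (contracting_invariant_unique (incrP 1%:nng) contrP1 rho0 rho1) => //.
apply: eq_probability_means => h bh.
have [u tu] : exists u : {nonneg R}, t%:num + 1 = u%:num.
  by exists (t%:num + 1)%:nng.
have ut : 1 + t%:num = u%:num by rewrite addrC.
have PC : kernel_op (P t) (kernel_op P1 h) = kernel_op P1 (kernel_op (P t) h).
  apply: (etrans (@kernel_op_poissonD _ _ _ r Q t 1%:nng u h tu bh)).
  exact: esym (@kernel_op_poissonD _ _ _ r Q 1%:nng t u h ut bh).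
apply: (etrans (mean_kact (kact phi (P t)) P1 bh)).
apply: (etrans (mean_kact phi (P t) (bP 1%:nng bh))).
rewrite PC; apply: (etrans (mean_invariant sphi (bP t bh))).
exact: esym (mean_kact phi (P t) bh).
Qed.

Lemma kernel_op_poissonDn m s t h : s%:num + m%:R = t%:num ->
  bounded_measurable h ->
  kernel_op (P t) h = iter m (kernel_op P1) (kernel_op (P s) h).
Proof.
move=> + bh; elim: m t => [|m IHm] t smt.
  have -> : t = s by apply/val_inj; rewrite addr0 in smt; exact: esym smt.
  by [].
have [u su] : exists u : {nonneg R}, s%:num + m%:R = u%:num.
  by exists (s%:num + m%:R)%:nng.
have ut : 1 + u%:num = t%:num by rewrite -su -smt -natr1 addrC addrA.
rewrite iterS -(IHm _ su).
exact: esym (@kernel_op_poissonD _ _ _ r Q 1%:nng u t h ut bh).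
Qed.

(** After a time t - m, which does not raise the oscillation, m unit steps
    remain. *)
Lemma dist_stationary_le phi psi t h (m : nat) : stationary P psi ->
  m%:R <= t%:num -> ibS h ->
  `|\int[kact phi (P t)]_x h x - \int[psi]_x h x| <=
  rho ^+ m * (h (wmax wbar) - h (wmin wbar)).
Proof.
move=> spsi mt ih; have bh := ibS_bounded_measurable ih.
have iPh v : ibS (kernel_op (P v) h).
  exact: (increasing_kernelP (P v)).1 (incrP v) h ih.
have s0 : 0 <= t%:num - m%:R by rewrite subr_ge0.
pose s : {nonneg R} := NngNum s0.
rewrite mean_kact// -(mean_invariant (spsi t) bh).
apply: le_trans (dist_mean_le_oscillation (probability_setT phi)
  (probability_setT psi) (iPh t)) _.
rewrite (@kernel_op_poissonDn m s t)//; last by rewrite /= subrK.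
apply: le_trans (iter_contracts_oscillation m (incrP 1%:nng) contrP1 rho0 (iPh s)) _.
apply: ler_wpM2l; first exact: exprn_ge0.
apply: lerB; [apply: kernel_op_le|apply: kernel_op_ge] => // y;
  [exact: ibS_le|exact: ibS_ge].
Qed.

End semigroup.
End wage_stability.

Theorem proposition5p1 (R : realType) (wbar : {posnum R})
    (Qu Qe : R.-pker wage_space wbar ~> wage_space wbar)
    (delta lambda : {posnum R})
    (what : wage_space wbar) (n : nat) (eps : R) :
  increasing_kernel Qu -> increasing_kernel Qe ->
  (0 < n)%N -> 0 < eps ->
  (eps%:E <= kpow Qu n (wmax wbar) `[wmin wbar, what]%classic)%E ->
  (eps%:E <= kpow Qe n (wmin wbar) `[what, wmax wbar]%classic)%E ->
  let P := wage_semigroup delta lambda Qu Qe in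
  let kappa := expR (- (delta%:num + lambda%:num)) *
    Num.min delta%:num lambda%:num ^+ n / n`!%:R * eps in
  let C := 2 / (1 - kappa) in
  let alpha := ln (1 / (1 - kappa)) in
  exists phistar : probability (wage_space wbar) R,
    globally_stable P phistar /\
    forall (phi : probability (wage_space wbar) R) (t : {nonneg R}),
      beta (kact phi (P t)) phistar <= C * expR (- alpha * t%:num).
Proof.
move=> iu ie n0 eps0 hu he P kappa C alpha.
have [ku ke] := wage_semigroup1_mixing delta lambda ie eps0 hu he.
rewrite -/kappa in ku ke.
have iK := increasing_jump delta lambda iu ie.
have kappa_gt0 : 0 < kappa by apply: mulr_gt0.
have kappa1 : kappa < 1.
  apply: kappa_lt1 => //; rewrite -lee_fin; apply: (le_trans hu).
  apply: le_trans (sprob_kernel_le1 (kpow Qu n) (wmax wbar)).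
  by apply: le_measure; rewrite ?inE//; rewrite itv_wminE; apply: measurableC;
    exact: measurable_above.
have rho0 : 0 <= 1 - kappa by rewrite subr_ge0 ltW.
have rho1 : 1 - kappa < 1 by rewrite ltrBlDr ltrDl.
have contrP1 := mixing_contracts_oscillation ku ke.
have [phistar sphi] := stationary_exists iK contrP1 rho0 rho1.
exists phistar.
have rho_gt0 : 0 < 1 - kappa by rewrite subr_gt0.
have alpha_gt0 : 0 < alpha by rewrite ln_gt0// div1r invf_gt1.
have rhoE : 1 - kappa = expR (- alpha).
  by rewrite /alpha div1r lnV ?posrE// opprK lnK ?posrE.
have rate (phi : probability (wage_space wbar) R) (t : {nonneg R}) :
    beta (kact phi (P t)) phistar <= C * expR (- alpha * t%:num).
  pose m := Num.truncn t%:num.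
  apply: (@le_trans _ _ ((1 - kappa) ^+ m * 2)).
    apply: beta_le => h ih h1.
    have mt : m%:R <= t%:num by rewrite truncn_le.
    apply: le_trans (dist_stationary_le iK contrP1 rho0 phi sphi mt ih) _.
    by apply: ler_wpM2l; [exact: exprn_ge0|exact: oscillation_le2].
  (* as t < m + 1, the factor (1 - kappa)^m is at most (1 - kappa)^(t - 1) *)
  rewrite /C mulrC -mulrA ler_pM2l// rhoE -expRN -expRM_natl -expRD ler_expR.
  have tm : t%:num < m%:R + 1 by rewrite natr1 truncnS_gt.
  have : alpha * (m%:R + 1 - t%:num) >= 0 by rewrite mulr_ge0 ?subr_ge0 ?ltW.
  by rewrite opprK; clear; lra.
split; last exact: rate.
split => // [psi spsi|phi].
  exact: (contracting_invariant_unique (increasing_poisson _ _ iK) contrP1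
    rho0 rho1 (spsi 1%:nng) (sphi 1%:nng)).
have cvC : C * expR (- (alpha * t)) @[t --> +oo] --> (0 : R).
  rewrite -[X in _ --> X](mulr0 C); apply: cvgMr.
  apply: (@cvg_comp _ _ _ _ (fun z => expR (- z)) _ (pinfty_nbhs R));
    last exact: cvgr_expR.
  exact: gt0_cvgMry.
apply: (@squeeze_cvgr _ _ _ _ (fun=> 0) (fun t => C * expR (- (alpha * t)))) => //.
  near=> t; rewrite beta_ge0/=; apply: le_trans (rate _ _) _.
  by rewrite /= ger0_norm ?mulNr//; near: t; exact: nbhs_pinfty_ge.
exact: cvg_cst.
Unshelve. all: by end_near. Qed.
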